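(* Let $q,n,d,m$ be positive integers with $q\ge 2$ such that $d=m\bigl(qd-(q-1)(n-1)\bigr)$ and such that $n-d$ does not divide $m(n-1)$. If $r\in\{1,\dots,q-1\}$ satisfies $$n(n-1-d)(r-1)r<(q-r+1)\bigl(qm(q+r-2)-2r\bigr),$$ then $A_q(n,d)<q^2m-r$.
   Context: For an integer $q\ge2$ let $[q]=\{0,1,\dots,q-1\}$. For words $u,v\in[q]^n$, the Hamming distance $d_H(u,v)$ is the number of coordinates $i$ with $u_i\neq v_i$. The minimum distance $d_{\min}(C)$ of a code $C\subseteq[q]^n$ is the minimum of $d_H(u,v)$ over distinct $u,v\in C$ (and $\infty$ if $|C|\le1$). $A_q(n,d)$ denotes the maximum cardinality of a code $C\subseteq[q]^n$ with $d_{\min}(C)\ge d$. *)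

(* Defs.v *)
From mathcomp Require Import all_boot all_order all_algebra.
Set Implicit Arguments. Unset Strict Implicit. Unset Printing Implicit Defensive.

Definition word (q n : nat) := n.-tuple 'I_q.

Definition hamming (q n : nat) (u v : word q n) : nat :=
  #|[set i : 'I_n | tnth u i != tnth v i]|.

(* C has minimum distance >= d (vacuous when |C| <= 1, matching d_min = oo). *)
Definition min_dist_ge (q n : nat) (C : {set word q n}) (d : nat) : bool :=
  [forall u in C, forall v in C, (u != v) ==> (d <= hamming u v)].

Definition A_q (q n d : nat) : nat :=
  \max_(C : {set word q n} | min_dist_ge C d) #|C|.

(* Main.v *)
(** Suppose a code [C] with minimum distance at least [d] has exactly [q^2 m - r]
    words.  The block of words with letter [a] in column [j] has [qm - s] words,
    where [s >= 0] by Plotkin, and the deficiencies [s] of a column add up to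
    [r].  Call a pair of words bad if its distance lies strictly between [d]
    and [n].  Counting distances inside a block in two ways shows that it has
    at most [(n-1-d) s (s-1)] bad ordered pairs; as a bad pair agrees somewhere,
    there are at most [n (n-1-d) r (r-1)] of them in total.  In a full block
    ([s = 0]) every other column contains each letter exactly [m] times, so the
    agreements of an outside word with it add up to [m(n-1)]; as [n-d] does not
    divide this, the outside word is in a bad pair with a member of the block.
    Hence a column with [k] non-full blocks forces at least
    [(q-k) (qm(q+k-1) - 2r)] bad pairs.  If some [s] is at least 2, then
    [k <= r-1] for its column and the hypothesis is violated; otherwise
    there is no bad pair at all, contradicting the positivity of this bound. *)

Require Import Defs.
From mathcomp Require Import all_boot all_order all_algebra.
From mathcomp Require Import zify ring lra.
Set Implicit Arguments. Unset Strict Implicit. Unset Printing Implicit Defensive.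
Import Order.TTheory GRing.Theory Num.Theory.
Local Open Scope ring_scope.

(** * Letter blocks and counting of agreements *)

Definition block (q n : nat) (B : {set word q n}) (i : 'I_n) (a : 'I_q) :
  {set word q n} := [set w in B | tnth w i == a].

Lemma sum_by_letter (q n : nat) (B : {set word q n}) (i : 'I_n)
    (F : word q n -> nat) :
  (\sum_(w in B) F w = \sum_a \sum_(w in block B i a) F w)%N.
Proof.
rewrite (partition_big (fun w => tnth w i) xpredT) //=.
by apply: eq_bigr => a _; apply: eq_bigl => w; rewrite inE.
Qed.

Lemma sum_card_block (q n : nat) (B : {set word q n}) (i : 'I_n) :
  (\sum_a #|block B i a| = #|B|)%N.
Proof.
rewrite -sum1_card (sum_by_letter _ i).
by apply: eq_bigr => a _; rewrite sum1_card.
Qed.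

Lemma sum_agree_column (q n : nat) (B : {set word q n}) (i : 'I_n) (a : 'I_q) :
  (\sum_(w in B) (a == tnth w i) = #|block B i a|)%N.
Proof.
rewrite -sum1_card big_mkcond [RHS]big_mkcond /=.
by apply: eq_bigr => w _; rewrite inE eq_sym; case: (w \in B); case: eqP.
Qed.

Lemma sum_agree_pairs (q n : nat) (B : {set word q n}) (i : 'I_n) :
  (\sum_(u in B) \sum_(v in B) (tnth u i == tnth v i)
   = \sum_a #|block B i a| ^ 2)%N.
Proof.
rewrite (sum_by_letter _ i); apply: eq_bigr => a _.
rewrite (eq_bigr (fun=> #|block B i a|)) ?sum_nat_const ?mulnn // => u.
by rewrite inE => /andP[_ /eqP->]; rewrite sum_agree_column.
Qed.

Lemma hamming_agree (q n : nat) (u v : word q n) :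
  (hamming u v + \sum_i (tnth u i == tnth v i) = n)%N.
Proof.
rewrite /hamming -sum1_card big_mkcond /= -big_split /=.
rewrite (eq_bigr (fun=> 1%N)) ?sum1_card ?card_ord // => i _.
by rewrite inE; case: eqP.
Qed.

Lemma hamming_sym (q n : nat) (u v : word q n) : hamming u v = hamming v u.
Proof.
by rewrite /hamming; apply: eq_card => i; rewrite !inE eq_sym.
Qed.

Lemma hammingxx (q n : nat) (u : word q n) : hamming u u = 0%N.
Proof. by apply/eqP; rewrite cards_eq0; apply/eqP/setP => i; rewrite !inE eqxx. Qed.

(** Each coordinate of an ordered pair either differs or agrees, and the agreeing pairs of a column
    are counted by the squares of its block sizes. *)
Lemma sum_hamming (q n : nat) (B : {set word q n}) :
  (\sum_(u in B) \sum_(v in B) hamming u v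
   + \sum_i \sum_a #|block B i a| ^ 2 = n * #|B| ^ 2)%N.
Proof.
under [X in (_ + X)%N]eq_bigr do rewrite -sum_agree_pairs.
rewrite [X in (_ + X)%N]exchange_big -big_split /=.
rewrite (eq_bigr (fun=> (n * #|B|)%N)).
  by rewrite sum_nat_const mulnCA mulnn.
move=> u _; rewrite [X in (_ + X)%N]exchange_big -big_split /=.
rewrite (eq_bigr (fun=> n)) => [|v _]; last exact: hamming_agree.
by rewrite sum_nat_const mulnC.
Qed.

Lemma block_sub (q n : nat) (B : {set word q n}) (i : 'I_n) (a : 'I_q) :
  block B i a \subset B.
Proof. by apply/subsetP => w; rewrite inE => /andP[]. Qed.

Lemma sum_sqr_block_self (q n : nat) (C : {set word q n}) (j : 'I_n) (a : 'I_q) :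
  let B := block C j a in (\sum_b #|block B j b| ^ 2 = #|B| ^ 2)%N.
Proof.
move=> B; rewrite (bigD1 a) //= big1 => [|b ba].
  rewrite addn0; suff -> : block B j a = B by [].
  by apply/setP => w; rewrite !inE -andbA andbb.
suff -> : block B j b = set0 by rewrite cards0.
apply/setP => w; rewrite !inE.
by apply/negP => /andP[/andP[_ /eqP->]] /eqP ab; rewrite ab eqxx in ba.
Qed.

(** * Excess over the minimum distance inside a block *)

Definition separated (q n d : nat) (C : {set word q n}) : Prop :=
  forall u v, u \in C -> v \in C -> u != v -> (d <= hamming u v)%N.

Lemma separatedS (q n d : nat) (C D : {set word q n}) :
  D \subset C -> separated d C -> separated d D.
Proof.
by move=> /subsetP DC hC u v uD vD; apply: hC; apply: DC.
Qed.

(** The natural subtraction is exact when [B] is separated, where this measures how far [B] is from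
    being equidistant. *)
Definition excess (q n d : nat) (B : {set word q n}) : nat :=
  (\sum_(u in B) \sum_(v in B | v != u) (hamming u v - d))%N.

Lemma sum_hamming_excess (q n d : nat) (B : {set word q n}) :
  separated d B ->
  (\sum_(u in B) \sum_(v in B) hamming u v
   = excess d B + d * (#|B| * #|B|.-1))%N.
Proof.
move=> hB.
have -> : (d * (#|B| * #|B|.-1) = \sum_(u in B) d * #|B|.-1)%N.
  by rewrite sum_nat_const mulnCA.
rewrite -big_split; apply: eq_bigr => u uB /=.
rewrite (bigD1 u) //= hammingxx add0n.
have -> : (d * #|B|.-1 = \sum_(v in B | v != u) d)%N.
  rewrite sum_nat_const mulnC; congr (_ * _)%N.
  rewrite (cardD1 u) uB /=; apply: eq_card => v.
  by rewrite !inE andbC.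
rewrite -big_split; apply: eq_bigr => v /andP[vB vu] /=.
by rewrite subnK // hB // eq_sym.
Qed.

(** Algebraic core of [block_excess_identity]: [E] is the excess, [Q * M - s] the block size, and
    [T] the sum of squared letter counts over the other columns. *)
Lemma excess_arith (Q M N D s E T : int) :
  D = M * (Q * D - (Q - 1) * (N - 1)) ->
  E + D * ((Q * M - s) * (Q * M - s - 1)) + ((Q * M - s) * (Q * M - s) + T)
    = N * ((Q * M - s) * (Q * M - s)) ->
  E + (T - (N - 1) * ((2 * M - 1) * (Q * M - s))
       + (N - 1) * (Q * (M * (M - 1))))
  = (N - 1 - D) * (s * (s - 1)).
Proof.
move=> /eqP; rewrite -subr_eq0 => /eqP hd /eqP; rewrite -subr_eq0 => /eqP hN.
apply/eqP; rewrite -subr_eq0.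
set X := (X in X = 0) in hd; set Y := (Y in Y = 0) in hN.
(* The multiplier comes from comparing coefficients of [D], since [s * (s - 1) - (Q * M - s) * (Q *
   M - s - 1)] equals [(2 * s - Q * M) * (Q * M - 1)]. *)
have -> : 0 = Y + (Q * M - 2 * s) * X by rewrite hd hN mulr0 addr0.
by apply/eqP; rewrite /X /Y; ring.
Qed.

Lemma sum_other_columns (n : nat) (j : 'I_n) (x : int) :
  \sum_(i : 'I_n | i != j) x = (n%:Z - 1) * x.
Proof.
rewrite sumr_const -mulr_natl natz; congr (_ * _).
by rewrite (cardC1 j) card_ord; have := ltn_ord j; lia.
Qed.

Lemma block_excess (q n d : nat) (C : {set word q n}) (j : 'I_n) (a : 'I_q) :
  let B := block C j a in
  separated d C ->
  (excess d B)%:Z + d%:Z * (#|B|%:Z * (#|B|%:Z - 1))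
  + (#|B|%:Z * #|B|%:Z + \sum_(i | i != j) (\sum_b #|block B i b| ^ 2)%N%:Z)
  = n%:Z * (#|B|%:Z * #|B|%:Z).
Proof.
move=> B hC.
have hB : separated d B by apply: separatedS hC; exact: block_sub.
have := sum_hamming B.
rewrite (sum_hamming_excess hB) (bigD1 j) //= sum_sqr_block_self -/B.
move=> /(congr1 Posz).
have hM : (#|B| * #|B|.-1)%:Z = #|B|%:Z * (#|B|%:Z - 1) :> int.
  by case: #|B| => [|k] //=; rewrite PoszM; lia.
have -> : \sum_(i | i != j) (\sum_b #|block B i b| ^ 2)%N%:Z
  = (\sum_(i | i != j) (\sum_b #|block B i b| ^ 2))%N%:Z.
  by rewrite -[RHS]natz natr_sum; apply: eq_bigr => i _; rewrite natz.
by rewrite -!mulnn !PoszD !PoszM -PoszM hM.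
Qed.

(* Two-sided count of the distances in a block.  The slack terms
   [(c - m) (c - m + 1)] vanish exactly when [c] is [m] or [m - 1], which is the
   optimal distribution of letters in a column of [qm - s] words, [0 <= s <= q]. *)
Lemma block_excess_identity (q n d m : nat) (C : {set word q n})
    (j : 'I_n) (a : 'I_q) (s : int) :
  let B := block C j a in
  separated d C ->
  d%:Z = m%:Z * (q%:Z * d%:Z - (q%:Z - 1) * (n%:Z - 1)) ->
  #|B|%:Z = q%:Z * m%:Z - s ->
  (excess d B)%:Z
  + \sum_(i | i != j) \sum_b
      (#|block B i b|%:Z - m%:Z) * (#|block B i b|%:Z - m%:Z + 1)
  = (n%:Z - 1 - d%:Z) * (s * (s - 1)).
Proof.
move=> B hC hd hs.
have hS i : \sum_b (#|block B i b|%:Z - m%:Z) * (#|block B i b|%:Z - m%:Z + 1)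
  = (\sum_b #|block B i b| ^ 2)%N%:Z - (2 * m%:Z - 1) * #|B|%:Z
    + q%:Z * (m%:Z * (m%:Z - 1)).
  have -> : q%:Z * (m%:Z * (m%:Z - 1)) = \sum_(b : 'I_q) m%:Z * (m%:Z - 1).
    by rewrite sumr_const card_ord -mulr_natl natz.
  rewrite -(sum_card_block B i) -!natz !natr_sum mulr_sumr -sumrB -big_split /=.
  by apply: eq_bigr => b _; rewrite natrX !natz; ring.
under eq_bigr do rewrite hS.
rewrite big_split /= sumrB !sum_other_columns.
have := block_excess j a hC.
rewrite -/B hs.
exact: excess_arith.
Qed.

(** * Plotkin bound and structure of full blocks *)

Lemma dist_lt_length (q n d m : nat) :
  (0 < n)%N -> (0 < d)%N -> (2 <= q)%N ->
  d%:Z = m%:Z * (q%:Z * d%:Z - (q%:Z - 1) * (n%:Z - 1)) -> (d < n)%N.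
Proof.
move=> n0 d0 q2 hd; rewrite ltnNge; apply/negP => nd.
have d1 : 0 < d%:Z by lia.
have m1 : 1 <= m%:Z by case: m hd => [|m] //; rewrite mul0r; lia.
(* If [n <= d], the factor multiplied by [m] is [d + (q - 1) * (d - (n - 1))], which exceeds [d];
   its product with [m >= 1] cannot equal [d]. *)
have : 0 <= (m%:Z - 1) * (q%:Z * d%:Z - (q%:Z - 1) * (n%:Z - 1)).
  have h0 : 0 <= (q%:Z - 1) * (d%:Z - (n%:Z - 1)) by apply: mulr_ge0; lia.
  by apply: mulr_ge0; [lia|lra].
have h1 : 0 < (q%:Z - 1) * (d%:Z - (n%:Z - 1)) by apply: mulr_gt0; lia.
lra.
Qed.

(** Cauchy-Schwarz, read off from the sum of squared deviations from the mean, scaled by [q] to stay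
    in the integers. *)
Lemma sqr_sum_le (q : nat) (c : 'I_q -> nat) :
  (\sum_a c a)%N%:Z ^+ 2 <= q%:Z * (\sum_a c a ^ 2)%N%:Z.
Proof.
set M := (\sum_a c a)%N; set S := (\sum_a _)%N.
have [q0|q0] := posnP q.
  by subst q; rewrite /M big_ord0 mul0r.
have : 0 <= \sum_a (q%:Z * (c a)%:Z - M%:Z) ^+ 2.
  by apply: sumr_ge0 => a _; exact: sqr_ge0.
have -> : \sum_a (q%:Z * (c a)%:Z - M%:Z) ^+ 2
  = q%:Z * (q%:Z * S%:Z - M%:Z ^+ 2).
  rewrite (eq_bigr (fun a => q%:Z ^+ 2 * (c a ^ 2)%N%:Z
    - 2 * q%:Z * M%:Z * (c a)%:Z + M%:Z ^+ 2)) => [|a _].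
    rewrite big_split sumrB -!mulr_sumr /= sumr_const card_ord -mulr_natl !natz.
    have -> : \sum_a (c a)%:Z = M%:Z.
      by rewrite -[RHS]natz natr_sum; apply: eq_bigr => a _; rewrite natz.
    have -> : \sum_a (c a ^ 2)%N%:Z = S%:Z.
      by rewrite -[RHS]natz natr_sum; apply: eq_bigr => a _; rewrite natz.
    ring.
  by rewrite -mulnn PoszM; ring.
by rewrite pmulr_rge0 ?subr_ge0 // ltz_nat.
Qed.

(** Plotkin's argument: Cauchy-Schwarz in the other columns gives [#|B| * e <= q * d] with [e] as
    below, and [d = m * e] with [e > 0]. *)
Lemma card_block_le (q n d m : nat) (C : {set word q n})
    (j : 'I_n) (a : 'I_q) :
  (0 < d)%N -> separated d C ->
  d%:Z = m%:Z * (q%:Z * d%:Z - (q%:Z - 1) * (n%:Z - 1)) ->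
  (#|block C j a| <= q * m)%N.
Proof.
move=> d0 hC hd; have := block_excess j a hC.
set B := block C j a; set T := \sum_(i | _) _.
have hT : (n%:Z - 1) * (#|B|%:Z * #|B|%:Z) <= q%:Z * T.
  rewrite -(sum_other_columns j) /T mulr_sumr; apply: ler_sum => i _.
  by rewrite -expr2 -{1}(sum_card_block B i); apply: sqr_sum_le.
move=> hE; have [->//|B0] := posnP #|B|.
set e := q%:Z * d%:Z - (q%:Z - 1) * (n%:Z - 1).
have e0 : 0 < e.
  have : 0 < m%:Z * e by rewrite -hd ltz_nat.
  by case: (m) => [|m']; [rewrite mul0r|rewrite pmulr_rgt0].
have h1 : 0 <= #|B|%:Z * (q%:Z * d%:Z - #|B|%:Z * e).
  have : 0 <= q%:Z * (excess d B)%:Z by rewrite mulr_ge0.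
  have -> : (excess d B)%:Z = n%:Z * (#|B|%:Z * #|B|%:Z)
    - (d%:Z * (#|B|%:Z * (#|B|%:Z - 1))) - (#|B|%:Z * #|B|%:Z + T).
    by rewrite -hE; ring.
  move: hT; rewrite /e -subr_ge0 => h1 h2; move: (addr_ge0 h1 h2).
  by congr (0 <= _); ring.
by rewrite pmulr_rge0 ?ltz_nat // {1}hd -/e subr_ge0 mulrA ler_pM2r in h1.
Qed.

Lemma consecutive_mul_ge0 (x : int) : 0 <= x * (x + 1).
Proof. nia. Qed.

Lemma excess_le (q n d m : nat) (C : {set word q n})
    (j : 'I_n) (a : 'I_q) :
  let s := (q * m - #|block C j a|)%N in
  (0 < d < n)%N -> separated d C ->
  d%:Z = m%:Z * (q%:Z * d%:Z - (q%:Z - 1) * (n%:Z - 1)) ->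
  (excess d (block C j a) <= (n - 1 - d) * (s * s.-1))%N.
Proof.
move=> s /andP[d0 dn] hC hd; have hle := card_block_le j a d0 hC hd.
have hs : #|block C j a|%:Z = q%:Z * m%:Z - s%:Z.
  by rewrite /s -subzn // PoszM; ring.
have := block_excess_identity hC hd hs.
set T := \sum_(i | _) _ => hE.
have T0 : 0 <= T.
  by do 2![apply: sumr_ge0 => ? _]; apply: consecutive_mul_ge0.
have -> : (n - 1 - d)%N = (n - d.+1)%N by lia.
rewrite -lez_nat PoszM -subzn //.
have -> : (s * s.-1)%N%:Z = s%:Z * (s%:Z - 1).
  by case: (s) => [|k]; rewrite ?mul0n ?mul0r // PoszM; congr (_ * _); lia.
have -> : n%:Z - d.+1%:Z = n%:Z - 1 - d%:Z by lia.
by rewrite -hE lerDl.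
Qed.

(** At [s = 0] the slack in [block_excess_identity] vanishes, so every letter count is [m] or
    [m - 1]; a total of [q * m] leaves only [m]. *)
Lemma full_block_balanced (q n d m : nat) (C : {set word q n})
    (i j : 'I_n) (a b : 'I_q) :
  (0 < d)%N -> separated d C ->
  d%:Z = m%:Z * (q%:Z * d%:Z - (q%:Z - 1) * (n%:Z - 1)) ->
  #|block C j a| = (q * m)%N -> i != j ->
  #|block (block C j a) i b| = m.
Proof.
move=> d0 hC hd hf ij; set B := block C j a.
have hs : #|B|%:Z = q%:Z * m%:Z - 0 by rewrite hf PoszM subr0.
have := block_excess_identity hC hd hs.
rewrite mul0r mulr0 -/B => /eqP.
rewrite paddr_eq0 ?lez_nat //; last first.
  by do 2![apply: sumr_ge0 => ? _]; apply: consecutive_mul_ge0.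
move=> /andP[_ /eqP /psumr_eq0P h0].
have {h0} h0 c : (#|block B i c|%:Z - m%:Z) * (#|block B i c|%:Z - m%:Z + 1) = 0.
  have := h0 _ i ij.
  have h1 i' : 0 <= \sum_b0 (#|block B i' b0|%:Z - m%:Z)
                 * (#|block B i' b0|%:Z - m%:Z + 1).
    by apply: sumr_ge0 => ? _; apply: consecutive_mul_ge0.
  move=> /(_ (fun i' _ => h1 i')) /psumr_eq0P; apply=> // *.
  exact: consecutive_mul_ge0.
have hle c : (#|block B i c| <= m)%N.
  by have /eqP := h0 c; rewrite mulf_eq0 => /orP[] /eqP; lia.
apply/eqP; rewrite eqn_leq hle /=.
have := sum_card_block B i; rewrite hf (bigD1 b) //= => hsum.
have : (\sum_(c < q | c != b) #|block B i c| <= \sum_(c < q | c != b) m)%N.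
  by apply: leq_sum.
rewrite sum_nat_const.
have -> : (#|[pred c | c != b]| = q.-1)%N by rewrite (cardC1 b) card_ord.
have q0 : (0 < q)%N by apply: leq_ltn_trans (ltn_ord b).
have : (q * m = m + q.-1 * m)%N by rewrite -mulSn prednK.
rewrite -hsum => e hS.
by rewrite -(leq_add2r (q.-1 * m)) -e leq_add2l.
Qed.

(** * Upper and lower bounds on the number of bad pairs *)

Definition bad (q n d : nat) (u v : word q n) : bool := (d < hamming u v < n)%N.

Lemma bad_sym (q n d : nat) (u v : word q n) : bad d u v = bad d v u.
Proof. by rewrite /bad hamming_sym. Qed.

Lemma sum_bad_le_excess (q n d : nat) (B : {set word q n}) :
  (\sum_(u in B) \sum_(v in B) bad d u v <= excess d B)%N.
Proof.
apply: leq_sum => u uB; rewrite (bigD1 u) //= {1}/bad hammingxx add0n.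
by apply: leq_sum => v _; rewrite /bad; case: andP => // -[]; lia.
Qed.

(** A pair that is not bad is at distance [d] or [n], so it has [n - d] or no agreements. With no
    bad pair, [n - d] would divide the total number of agreements. *)
Lemma full_block_bad (q n d m : nat) (C : {set word q n})
    (j : 'I_n) (a : 'I_q) (u : word q n) :
  (0 < d)%N -> (d < n)%N -> separated d C ->
  d%:Z = m%:Z * (q%:Z * d%:Z - (q%:Z - 1) * (n%:Z - 1)) ->
  ~~ ((n - d) %| m * (n - 1))%N ->
  #|block C j a| = (q * m)%N -> u \in C -> tnth u j != a ->
  (1 <= \sum_(w in block C j a) bad d u w)%N.
Proof.
move=> d0 dn hC hd hdvd hf uC uja; rewrite lt0n sum_nat_eq0.
apply: contra hdvd => /forall_inP hbad.
have <- : (\sum_(w in block C j a) \sum_i (tnth u i == tnth w i)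
           = m * (n - 1))%N.
  (* Column [j] contributes nothing, as [u] differs there from the whole block; each other column
     contributes [m]. *)
  rewrite exchange_big (bigD1 j) //= sum_agree_column.
  rewrite (eq_bigr (fun=> m)) => [|i ij]; last first.
    by rewrite sum_agree_column; apply: full_block_balanced hd hf ij.
  rewrite sum_nat_const (cardC1 j) card_ord.
  suff -> : block (block C j a) j (tnth u j) = set0 by rewrite cards0; lia.
  apply/setP => w; rewrite !inE; apply/negP => /andP[/andP[_ /eqP wa]].
  by rewrite wa eq_sym (negPf uja).
apply: dvdn_sum => w wB; have := hbad w wB.
have wC : w \in C by apply: subsetP wB; exact: block_sub.
have uw : u != w.
  by apply: contraNneq uja => ->; move: wB; rewrite inE => /andP[].
have := hC u w uC wC uw; have := hamming_agree u w.
rewrite /bad; set h := hamming u w; set s := (\sum_i _)%N => hs dh.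
rewrite eqb0 negb_and -!leqNgt => /orP[hd'|nh].
  by have -> : s = (n - d)%N by lia.
by have -> : s = 0%N by lia.
Qed.

Definition bad_pairs (q n d : nat) (C : {set word q n}) : nat :=
  (\sum_(u in C) \sum_(v in C) bad d u v)%N.

(** The right side counts a bad pair once per column of agreement, and distance below [n] ensures
    one such column. *)
Lemma bad_pairs_le_blocks (q n d : nat) (C : {set word q n}) :
  (bad_pairs d C <= \sum_j \sum_a \sum_(u in block C j a)
     \sum_(v in block C j a) bad d u v)%N.
Proof.
have -> : (\sum_j \sum_a \sum_(u in block C j a)
     \sum_(v in block C j a) bad d u v
   = \sum_(u in C) \sum_(v in C) \sum_j (tnth u j == tnth v j) * bad d u v)%N.
  under [RHS]eq_bigr do rewrite exchange_big /=.
  rewrite [RHS]exchange_big /=; apply: eq_bigr => j _.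
  rewrite [RHS](sum_by_letter _ j); apply: eq_bigr => a _.
  apply: eq_bigr => u; rewrite inE => /andP[_ /eqP ->].
  rewrite big_mkcond [RHS]big_mkcond /=; apply: eq_bigr => v _.
  rewrite inE eq_sym; case: (v \in C) => //=.
  by case: eqP => _; rewrite ?mul1n ?mul0n.
apply: leq_sum => u _; apply: leq_sum => v _; rewrite -big_distrl /=.
have [/andP[_ hn]|_] := boolP (bad d u v); last by [].
by rewrite muln1 -(ltn_add2l (hamming u v)) addn0 hamming_agree.
Qed.

Lemma sum_deficiency (q n m r : nat) (C : {set word q n}) (j : 'I_n) :
  (forall a, #|block C j a| <= q * m)%N ->
  (#|C| + r = q ^ 2 * m)%N ->
  (\sum_a (q * m - #|block C j a|) = r)%N.
Proof.
move=> hle hc; apply/eqP; rewrite -(eqn_add2l #|C|) hc.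
rewrite -[X in (X + _)%N](sum_card_block C j) -big_split /=.
rewrite (eq_bigr (fun=> q * m)%N) => [|a _]; last by rewrite subnKC.
by rewrite sum_nat_const card_ord mulnA mulnn.
Qed.

(** Each deficiency [s] is at most [r], so [s * s.-1 <= s * r.-1], and the deficiencies of a column
    sum to [r]. *)
Lemma bad_pairs_le (q n d m r : nat) (C : {set word q n}) :
  (0 < d < n)%N -> separated d C ->
  d%:Z = m%:Z * (q%:Z * d%:Z - (q%:Z - 1) * (n%:Z - 1)) ->
  (#|C| + r = q ^ 2 * m)%N ->
  (bad_pairs d C <= n * ((n - 1 - d) * (r * r.-1)))%N.
Proof.
move=> dn hC hd hc; apply: leq_trans (bad_pairs_le_blocks d C) _.
rewrite -[X in (_ <= X * _)%N](card_ord n) -sum_nat_const; apply: leq_sum => j _.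
have d0 : (0 < d)%N by case/andP: dn.
have hr := sum_deficiency (fun a => card_block_le j a d0 hC hd) hc.
rewrite -{1}hr big_distrl big_distrr /=; apply: leq_sum => a _.
apply: leq_trans (sum_bad_le_excess _ _) _.
apply: leq_trans (excess_le j a dn hC hd) _.
rewrite leq_mul2l leq_mul2l; apply/orP; right; apply/orP; right.
by rewrite -hr (bigD1 a) //=; lia.
Qed.

Definition full_letters (q n m : nat) (C : {set word q n}) (j : 'I_n) :
  {set 'I_q} := [set a | #|block C j a| == (q * m)%N].

(** Each of the [f] full blocks supplies a bad partner to every word outside it; words in non-full
    blocks have [f] such partners and are counted in both orders. *)
Lemma bad_pairs_ge (q n d m : nat) (C : {set word q n}) (j : 'I_n) :
  (0 < d < n)%N -> separated d C ->
  d%:Z = m%:Z * (q%:Z * d%:Z - (q%:Z - 1) * (n%:Z - 1)) ->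
  ~~ ((n - d) %| m * (n - 1))%N ->
  let f := #|full_letters m C j| in
  is_true (f * (#|C| - q * m) + f * (#|C| - f * (q * m)) <= bad_pairs d C)%N.
Proof.
move=> /andP[d0 dn] hC hd hdvd f; set F := full_letters m C j in f *.
pose full (w : word q n) := tnth w j \in F.
have hfull u a : u \in C -> a \in F -> tnth u j != a ->
    (1 <= \sum_(w in block C j a) bad d u w)%N.
  rewrite inE => uC /eqP hf uja.
  exact: full_block_bad hd hdvd hf uC uja.
have sum_full u : (\sum_(w in C | full w) bad d u w
    = \sum_(a in F) \sum_(w in block C j a) bad d u w)%N.
  rewrite (partition_big (fun w => tnth w j) (mem F)) /= => [|w /andP[]//].
  apply: eq_bigr => a aF; apply: eq_bigl => w; rewrite inE /full.
  by case: eqP => [->|]; rewrite ?aF ?andbT ?andbF.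
have -> : bad_pairs d C = (\sum_(u in C) \sum_(w in C | full w) bad d u w
    + \sum_(u in C) \sum_(w in C | ~~ full w) bad d u w)%N.
  by rewrite -big_split /=; apply: eq_bigr => u _; rewrite (bigID full).
(* First summand: second word in a full block.  Second summand: second word in a
   non-full block, bounded below by swapping the two words. *)
apply: leq_add.
  under eq_bigr do rewrite sum_full.
  rewrite exchange_big /= -sum_nat_const; apply: leq_sum => a aF.
  have <- : #|[set u in C | tnth u j != a]| = (#|C| - q * m)%N.
    move: (aF); rewrite inE => /eqP <-.
    rewrite -(cardsID (block C j a) C) (setIidPr (block_sub C j a)) addKn.
    by apply: eq_card => w; rewrite !inE; case: (w \in C); case: (_ == a).
  rewrite -sum1_card [X in (_ <= X)%N](big_setID [set u in C | tnth u j != a]) /=.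
  rewrite (setIidPr _); last by apply/subsetP => w; rewrite inE => /andP[].
  apply: leq_trans (leq_addr _ _); apply: leq_sum => u.
  by rewrite inE => /andP[uC]; apply: hfull.
have <- : #|[set w in C | ~~ full w]| = (#|C| - f * (q * m))%N.
  rewrite -(cardsID [set w in C | full w] C).
  have -> : #|C :&: [set w in C | full w]| = (f * (q * m))%N.
    rewrite (setIidPr _); last by apply/subsetP => w; rewrite inE => /andP[].
    rewrite -sum_nat_const -sum1_card.
    rewrite (partition_big (fun w => tnth w j) (mem F)) /= => [|w]; last first.
      by rewrite inE => /andP[].
    apply: eq_bigr => a aF; move: (aF); rewrite inE => /eqP <-.
    rewrite -sum1_card; apply: eq_bigl => w; rewrite !inE.
    by case: eqP => [e|]; rewrite ?andbF // /full e aF !andbT.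
  rewrite addKn; apply: eq_card => w; rewrite !inE.
  by case: (w \in C); case: (full w).
under eq_bigr do under eq_bigr do rewrite bad_sym.
rewrite (exchange_big_dep (fun w => (w \in C) && ~~ full w)) //=.
rewrite -sum1_card big_distrr /=.
rewrite [X in (X <= _)%N](eq_bigl (fun w => (w \in C) && ~~ full w)) => [|w];
  last by rewrite inE.
apply: leq_sum => w /andP[wC wF].
(* Only partners in full blocks are kept, at least one for each letter of [F]. *)
rewrite (bigID full) /=; apply: leq_trans (leq_addr _ _).
rewrite (eq_bigl (fun u => (u \in C) && full u)) => [|u];
  last by rewrite wC wF /= andbT.
rewrite sum_full muln1 /f -sum1_card; apply: leq_sum => a aF.
by apply: hfull => //; apply: contraNneq wF => ewa; rewrite /full ewa.
Qed.

(** * Number of non-full blocks and the final contradiction *)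

Lemma card_nonfull (q n m r : nat) (C : {set word q n}) (j : 'I_n) :
  (forall a, #|block C j a| <= q * m)%N ->
  (#|C| + r = q ^ 2 * m)%N ->
  let k := #|~: full_letters m C j| in
  [/\ (k <= r)%N, (0 < r -> 0 < k)%N
    & forall a, (2 <= q * m - #|block C j a| -> k < r)%N].
Proof.
move=> hle hc k; have hr := sum_deficiency hle hc.
have hN a : (a \in ~: full_letters m C j <= q * m - #|block C j a|)%N.
  rewrite !inE; have := hle a; case: eqP => //=; lia.
have hk : k = (\sum_a (a \in ~: full_letters m C j))%N.
  rewrite /k -sum1_card big_mkcond.
  by apply: eq_bigr => a _; case: (_ \in _).
split.
- by rewrite hk -hr; apply: leq_sum.
- move=> r0; rewrite lt0n; apply/negP => /eqP k0.
  suff : r = 0%N by lia.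
  rewrite -hr; apply: big1 => a _; move: (cards0_eq k0) => /setP /(_ a).
  by rewrite !inE => /negbFE /eqP ->; rewrite subnn.
(* The letter [a] adds at least 2 to the deficiency sum but only 1 to [k], whence the strict
   inequality. *)
- move=> a ha; rewrite hk -hr (bigD1 a) //= [X in (_ < X)%N](bigD1 a) //=.
  rewrite -addSn; apply: leq_add; last exact: leq_sum.
  by apply: leq_trans ha; case: (_ \in _).
Qed.

(** The left side is the right side at [k = r - 1], so only this extreme value has to be excluded by
    the numerical hypothesis. *)
Lemma nonfull_bound_mono (Q M r k : int) :
  2 <= Q -> 1 <= M -> r <= Q - 1 -> 1 <= k -> k <= r - 1 ->
  (Q - r + 1) * (Q * M * (Q + r - 2) - 2 * r)
    <= (Q - k) * (Q * M * (Q + k - 1) - 2 * r).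
Proof.
move=> Q2 M1 rQ k1 kr; rewrite -subr_ge0.
have -> : (Q - k) * (Q * M * (Q + k - 1) - 2 * r)
    - (Q - r + 1) * (Q * M * (Q + r - 2) - 2 * r)
  = (r - 1 - k) * (Q * M * (r + k - 2) - 2 * r) by ring.
have [->|hk] := eqVneq k (r - 1); first by rewrite subrr mul0r.
apply: mulr_ge0; first lia.
(* Now [1 <= k <= r - 2], hence [r >= 3] and [r + k >= 4]. *)
have h : 0 <= (M - 1) * Q by apply: mulr_ge0; lia.
have h' : 0 <= (Q * M) * (r + k - 4) by apply: mulr_ge0; lia.
have -> : Q * M * (r + k - 2) - 2 * r
  = Q * M * (r + k - 4) + 2 * ((M - 1) * Q) + 2 * (Q - r) by ring.
lia.
Qed.

Lemma no_code_of_card (q n d m r : nat) (C : {set word q n}) :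
  (2 <= q)%N -> (0 < n)%N -> (0 < d)%N -> (0 < m)%N ->
  d%:Z = m%:Z * (q%:Z * d%:Z - (q%:Z - 1) * (n%:Z - 1)) ->
  ~~ ((n - d) %| m * (n - 1))%N ->
  (1 <= r)%N -> (r <= q - 1)%N ->
  n%:Z * (n%:Z - 1 - d%:Z) * (r%:Z - 1) * r%:Z
    < (q%:Z - r%:Z + 1) * (q%:Z * m%:Z * (q%:Z + r%:Z - 2) - 2 * r%:Z) ->
  separated d C -> (#|C| + r <> q ^ 2 * m)%N.
Proof.
move=> q2 n0 d0 m0 hd hdvd r1 rq hlt hC hc.
have dn : (0 < d < n)%N by rewrite d0 (dist_lt_length n0 d0 q2 hd).
have hle j a := card_block_le j a d0 hC hd.
have hup := bad_pairs_le dn hC hd hc.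
have hlow j : let k := #|~: full_letters m C j| in
    (q%:Z - k%:Z) * (q%:Z * m%:Z * (q%:Z + k%:Z - 1) - 2 * r%:Z)
    <= (bad_pairs d C)%:Z.
  move=> k; have := bad_pairs_ge j dn hC hd hdvd; cbv zeta.
  have := card_nonfull (hle j) hc; rewrite -/k => -[kr /(_ r1) k0 _].
  have hf : (#|full_letters m C j| + k = q)%N by rewrite cardsC card_ord.
  move: hf; set f := #|full_letters m C j| => hf.
  have qm : (q <= q * m)%N by rewrite leq_pmulr.
  have sq : (q ^ 2 * m = f * (q * m) + k * (q * m))%N.
    by rewrite -mulnDl hf mulnA mulnn.
  have kqm : (q * m <= k * (q * m))%N by rewrite leq_pmull.
  (* The natural subtractions are exact: [r < q <= k * (q * m)] leaves room for the full blocks, and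
     [k <= r < q] makes at least one block full. *)
  have h1 : (f * (q * m) <= #|C|)%N by lia.
  have h2 : (q * m <= #|C|)%N.
    have f1 : (1 <= f)%N by lia.
    by apply: leq_trans h1; rewrite leq_pmull.
  rewrite -lez_nat PoszD !PoszM -!subzn // !PoszM.
  have -> : #|C|%:Z = q%:Z ^+ 2 * m%:Z - r%:Z.
    by rewrite -!PoszM -mulnn in hc *; lia.
  have -> : f%:Z = q%:Z - k%:Z by lia.
  by congr (_ <= _); ring.
have [/existsP[j /existsP[a ha]]|hno] :=
    boolP [exists j, exists a, 2 <= q * m - #|block C j a|]%N.
  have := hlow j; have := card_nonfull (hle j) hc.
  set k := #|_| => -[_ /(_ r1) k0 /(_ a ha) kr] /= hk.
  have : (bad_pairs d C)%:Z <= n%:Z * (n%:Z - 1 - d%:Z) * (r%:Z - 1) * r%:Z.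
    have -> : n%:Z * (n%:Z - 1 - d%:Z) * (r%:Z - 1) * r%:Z
        = (n * ((n - 1 - d) * (r * r.-1)))%N%:Z.
      have -> : r.-1 = (r - 1)%N by rewrite subn1.
      rewrite !PoszM -!subzn //; first ring.
      by lia.
    by rewrite lez_nat.
  have : (q%:Z - r%:Z + 1) * (q%:Z * m%:Z * (q%:Z + r%:Z - 2) - 2 * r%:Z)
    <= (q%:Z - k%:Z) * (q%:Z * m%:Z * (q%:Z + k%:Z - 1) - 2 * r%:Z).
    by apply: nonfull_bound_mono; lia.
  move=> h1 h2; have := le_lt_trans (le_trans hk h2) hlt.
  by rewrite ltNge h1.
(* All deficiencies are now 0 or 1, so [s * s.-1] vanishes in every block. *)
have bad0 : bad_pairs d C = 0%N.
  apply/eqP; rewrite -leqn0; apply: leq_trans (bad_pairs_le_blocks d C) _.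
  rewrite leqn0 sum_nat_eq0; apply/forall_inP => j _.
  rewrite sum_nat_eq0; apply/forall_inP => a _; rewrite -leqn0.
  apply: leq_trans (sum_bad_le_excess _ _) _.
  apply: leq_trans (excess_le j a dn hC hd) _.
  have : ~~ (2 <= q * m - #|block C j a|)%N.
    by apply: contra hno => h; apply/existsP; exists j; apply/existsP; exists a.
  by case: (_ - _)%N => [|[|]] //; rewrite !muln0.
have := hlow (Ordinal n0); rewrite bad0.
have := card_nonfull (hle (Ordinal n0)) hc.
set k := #|_| => -[kr /(_ r1) k0 _] /=; apply/negP; rewrite -ltNge.
apply: mulr_gt0; first lia.
(* The second factor is split into nonnegative terms and [2 * (q - r)], which is positive because
   [r < q]. *)
have : 0 <= (q%:Z * m%:Z - q%:Z) * (q%:Z + k%:Z - 1).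
  rewrite -PoszM subzn ?leq_pmulr //; apply: mulr_ge0 => //; lia.
have : 0 <= q%:Z * (k%:Z - 1) by apply: mulr_ge0; lia.
have : 0 <= (q%:Z - 2) * q%:Z by apply: mulr_ge0; lia.
have -> : q%:Z * m%:Z * (q%:Z + k%:Z - 1) - 2 * r%:Z
  = (q%:Z * m%:Z - q%:Z) * (q%:Z + k%:Z - 1) + (q%:Z * (k%:Z - 1)
    + (q%:Z - 2) * q%:Z + 2 * (q%:Z - r%:Z)) by ring.
move=> h1 h2 h3; apply: ltr_wpDl => //; apply: ltr_wpDl; first exact: addr_ge0.
by lia.
Qed.

Theorem theorem5p3 (q n d m r : nat) :
  (2 <= q)%N -> (0 < n)%N -> (0 < d)%N -> (0 < m)%N ->
  (d%:Z = m%:Z * (q%:Z * d%:Z - (q%:Z - 1) * (n%:Z - 1))) ->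
  ~~ ((n%:Z - d%:Z) %| m%:Z * (n%:Z - 1))%Z ->
  (1 <= r)%N -> (r <= q - 1)%N ->
  n%:Z * (n%:Z - 1 - d%:Z) * (r%:Z - 1) * r%:Z
    < (q%:Z - r%:Z + 1) * (q%:Z * m%:Z * (q%:Z + r%:Z - 2) - 2 * r%:Z) ->
  (A_q q n d)%:Z < (q ^ 2 * m)%:Z - r%:Z.
Proof.
move=> q2 n0 d0 m0 hd hdvd r1 rq hlt.
have dn := dist_lt_length n0 d0 q2 hd.
have hdvd' : ~~ ((n - d) %| m * (n - 1))%N.
  apply: contra hdvd.
  by rewrite subzn ?(ltnW dn) // subzn // -PoszM.
have rK : (r < q ^ 2 * m)%N.
  have : (q ^ 2 <= q ^ 2 * m)%N by rewrite leq_pmulr.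
  have : (q <= q ^ 2)%N by rewrite -mulnn leq_pmulr //; lia.
  lia.
rewrite subzn ?(ltnW rK) // ltz_nat.
have K0 : (0 < q ^ 2 * m - r)%N by lia.
rewrite -(prednK K0) ltnS; apply/bigmax_leqP => C hC.
(* A larger code is cut down to exactly [q ^ 2 * m - r] words, the only size that [no_code_of_card]
   excludes; subsets stay separated. *)
rewrite -ltnS (prednK K0) ltnNge; apply/negP => /card_geqP[s [us ss sC]].
pose D : {set word q n} := [set w in s].
have hD : separated d D.
  move=> u v; rewrite !inE => /sC uC /sC vC uv.
  by move/forall_inP: hC => /(_ u uC) /forall_inP /(_ v vC) /implyP; apply.
apply: (no_code_of_card q2 n0 d0 m0 hd hdvd' r1 rq hlt hD).
by rewrite cardsE (card_uniqP us) ss subnK // ltnW.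
Qed.
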